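(* Let $n \geq 2$, let $B^n = \{x \in \mathbb{R}^n : |x| < 1\}$, and let $f \colon B^n \to f(B^n) \subset \mathbb{R}^n$ be a proper continuous, open and discrete map. If the branch set satisfies $B_f = \emptyset$, then $f$ is a homeomorphism (onto its image $f(B^n)$).
   Context: A map $f \colon \Omega \to \mathbb{R}^n$ from a domain $\Omega \subset \mathbb{R}^n$ is open if it maps every open subset of $\Omega$ to an open set; discrete if for every point $y$ of the target the preimage $f^{-1}(y)$ is a discrete subset of $\Omega$; proper if the preimage of every compact set contained in $f(\Omega)$ is a compact subset of $\Omega$. The branch set $B_f$ is the set of points $x \in \Omega$ at which $f$ is not a local homeomorphism (equivalently, for such maps, not locally injective). *)

(* Defs.v *)
From mathcomp Require Import all_boot all_order all_algebra.
From mathcomp Require Import all_classical all_reals topology normedtype.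

Set Implicit Arguments.
Unset Strict Implicit.
Unset Printing Implicit Defensive.

Import Order.TTheory GRing.Theory Num.Theory.
Import numFieldNormedType.Exports.

Local Open Scope classical_set_scope.
Local Open Scope ring_scope.

(* The library's norm `|x| on row vectors is the sup norm; it induces the same
   topology, but its unit ball is a cube. *)
Definition eucl_norm (R : realType) (n : nat) (x : 'rV[R]_n) : R :=
  Num.sqrt (\sum_(i < n) x ord0 i ^+ 2).

Definition unit_ball (R : realType) (n : nat) : set 'rV[R]_n :=
  [set x | eucl_norm x < 1].

(* A map f : D -> Y with D a subset of X is represented by a total function
   X -> Y together with D; none of the notions below depends on the values of f
   outside D. *)
Section Maps.
Variables (X Y : ptopologicalType).
Implicit Types (D : set X) (E : set Y) (f : X -> Y).

(* D `&` U, for U open in X, is the general open subset of the subspace D. *)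
Definition open_map_on D f : Prop :=
  forall U : set X, open U -> open (f @` (D `&` U)).

Definition discrete_set (A : set X) : Prop := A `<=` isolated A.

Definition discrete_map_on D f : Prop :=
  forall y : Y, discrete_set (D `&` f @^-1` [set y]).

Definition proper_map_on D f : Prop :=
  forall K : set Y, compact K -> K `<=` f @` D -> compact (D `&` f @^-1` K).

Definition homeomorphism_on D E f : Prop :=
  [/\ set_fun D E f, {within D, continuous f} &
      exists g : Y -> X,
        [/\ set_fun E D g, {within E, continuous g},
            {in D, cancel f g} & {in E, cancel g f}]].

Definition local_homeomorphism_at D f (x : X) : Prop :=
  exists U : set X,
    [/\ open U, U x, U `<=` D, open (f @` U) & homeomorphism_on U (f @` U) f].

Definition branch_set D f : set X :=
  [set x | D x /\ ~ local_homeomorphism_at D f x].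

End Maps.

(* Main.v *)
(* If f (a) = f (b) with a <> b, then f, being a covering onto its image, lifts
   through itself to a map g of the ball with f o g = f and g (a) = b; since the
   fibres are finite, g has a finite order p > 1, and by uniqueness of lifts its
   powers g^i, 0 < i < p, have no fixed point. A convex set X admits no such
   action with a finite-dimensional quotient, because Z/p has cohomology in
   arbitrarily high degrees. Concretely: the target R^n is cut into small cells
   in 2^n ways (by the grids shifted by half a cell in some of the directions).
   Each grid yields an equivariant map l from X to Z/p, hence an invariant
   2-cocycle representing the generator of H^2(Z/p), and the cup product of these
   2^n cocycles vanishes on all tuples of points that are close enough to each
   other, because their images lie in a common cell of some grid. Convexity
   provides primitives, on smaller compact sets, that still vanish on close
   tuples. Descending degree by degree, with 1 - g and the trace
   1 + g + ... + g^(p-1) applied alternately to primitives, one reaches a function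
   that is both 0 and 1. *)
Require Import Defs.
From mathcomp Require Import all_boot all_order all_algebra.
From mathcomp Require Import all_classical all_reals topology normedtype.
From mathcomp Require Import zify ring lra.
Set Implicit Arguments.
Unset Strict Implicit.
Unset Printing Implicit Defensive.
Import Order.TTheory GRing.Theory Num.Theory.
Import numFieldNormedType.Exports.
Local Open Scope classical_set_scope.
Local Open Scope ring_scope.

(** * Cochains on tuples of points *)

Section Cochains.
Variables (X : Type) (A : comNzRingType).
Implicit Types (u v th psi : seq X -> A) (s : seq X).

(* The augmented alternating coboundary, on cochains of all degrees at once. *)
Fixpoint cobd u s : A :=
  if s is x :: s' then u s' - cobd (fun t => u (x :: t)) s' else 0.

Lemma eq_cobd u v : u =1 v -> cobd u =1 cobd v.
Proof.
move=> + s; elim: s u v => [//|x s IH] u v uv /=.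
by rewrite uv (IH _ (fun t => v (x :: t))).
Qed.

Lemma cobdD u v s : cobd (fun t => u t + v t) s = cobd u s + cobd v s.
Proof. by elim: s u v => [|x s IH] u v /=; rewrite ?addr0// IH; ring. Qed.

Lemma cobdB u v s : cobd (fun t => u t - v t) s = cobd u s - cobd v s.
Proof. by elim: s u v => [|x s IH] u v /=; rewrite ?subr0// IH; ring. Qed.

Lemma cobdM a u s : cobd (fun t => a * u t) s = a * cobd u s.
Proof. by elim: s u => [|x s IH] u /=; rewrite ?mulr0// IH; ring. Qed.

Lemma cobd0 s : cobd (fun=> 0) s = 0.
Proof. by elim: s => //= x s ->; rewrite subr0. Qed.

Lemma cobd_sum (F : nat -> seq X -> A) n s :
  cobd (fun t => \sum_(i < n) F i t) s = \sum_(i < n) cobd (F i) s.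
Proof.
elim: n => [|n IH].
  by rewrite big_ord0 -[RHS](cobd0 s); apply: eq_cobd => t; rewrite big_ord0.
rewrite [RHS]big_ord_recr /= -IH -cobdD; apply: eq_cobd => t.
by rewrite big_ord_recr.
Qed.

Lemma cobd_map (f : X -> X) u s : cobd (fun t => u (map f t)) s = cobd u (map f s).
Proof. by elim: s u => [|x s IH] u //=; rewrite -IH. Qed.

Lemma cobd_cobd u : cobd (cobd u) =1 (fun=> 0).
Proof.
move=> s; elim: s u => [//|x s IH] u /=.
by rewrite cobdB IH subr0 subrr.
Qed.

(** Coning with apex [x0]: expanding [cobd th] at [x0 :: s] leaves [th s] minus the coboundary of
    the cone. *)
Lemma cocycle_exact (x0 : X) th : cobd th =1 (fun=> 0) ->
  th =1 cobd (fun t => th (x0 :: t)).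
Proof.
move=> th0 s; have := th0 (x0 :: s); rewrite /= => /eqP.
by rewrite subr_eq0 => /eqP.
Qed.

(* The cochain homotopy from the pull-back by f to the pull-back by g. *)
Fixpoint prism (f g : X -> X) th s : A :=
  if s is x :: s' then
    th (f x :: map g (x :: s')) - prism f g (fun t => th (f x :: t)) s'
  else 0.

Lemma eq_prism f g u v : u =1 v -> prism f g u =1 prism f g v.
Proof.
move=> + s; elim: s u v => [//|x s IH] u v uv /=.
by rewrite uv (IH _ (fun t => v (f x :: t))).
Qed.

Lemma prismB f g u v s :
  prism f g (fun t => u t - v t) s = prism f g u s - prism f g v s.
Proof. by elim: s u v => [|x s IH] u v /=; rewrite ?subr0// IH; ring. Qed.

Lemma prism0 f g s : prism f g (fun=> 0) s = 0.
Proof. by elim: s => //= x s ->; rewrite subr0. Qed.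

Lemma prism_homotopy f g th s :
  cobd (prism f g th) s + prism f g (cobd th) s = th (map g s) - th (map f s).
Proof.
elim: s th => [|x s IH] th /=; first by rewrite addr0 subrr.
rewrite cobdB (prismB f g th) (cobd_map g (fun t => th [:: f x, g x & t])).
have h := IH (fun t => th (f x :: t)); rewrite /= in h.
have -> : th (f x :: map f s) = th (f x :: map g s) -
   (cobd (prism f g (fun t => th (f x :: t))) s +
    prism f g (cobd (fun t => th (f x :: t))) s) by rewrite h; ring.
ring.
Qed.

Lemma prism_eq0 f g th s (B : X -> Prop) :
    (forall t, (forall x, List.In x t -> B x) -> th t = 0) ->
    (forall x, List.In x s -> B (f x) /\ B (g x)) ->
  prism f g th s = 0.
Proof.
elim: s th => [//|x s IH] th th0 sB /=.
have [Bfx Bgx] := sB x (or_introl erefl).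
have sB' y : List.In y s -> B (f y) /\ B (g y) by move=> ys; apply: sB; right.
rewrite th0 => [|y /= [<-//|[<-//|]]]; last first.
  by move=> /List.in_map_iff[z [<- /sB' []]].
rewrite IH ?subrr// => t tB; apply: th0 => y /= [<-//|]; exact: tB.
Qed.

(** Only consecutive maps are compared, so [th] is evaluated on tuples mixing [h j] with [h j.+1];
    these stay small when the two maps are close. *)
Lemma telescope_prism (h : nat -> X -> X) (L : nat) th s :
    cobd th =1 (fun=> 0) ->
  cobd (fun t => \sum_(j < L) prism (h j) (h j.+1) th t) s =
  th (map (h L) s) - th (map (h 0%N) s).
Proof.
move=> dth; rewrite (cobd_sum (fun j => prism (h j) (h j.+1) th)).
elim: L => [|L IH]; first by rewrite big_ord0 subrr.
rewrite big_ord_recr /= IH.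
have := prism_homotopy (h L) (h L.+1) th s.
rewrite (eq_prism (h L) (h L.+1) dth) prism0 addr0 => ->; ring.
Qed.

End Cochains.

(** * Cyclic actions and cup products of degree 2 classes *)

Section Labels.
Variables (X : Type) (p : nat) (A : comNzRingType) (T : X -> X).
Hypotheses (p_gt1 : (1 < p)%N) (pA0 : p%:R = 0 :> A).
Hypothesis TK : forall x, iter p T x = x.
Implicit Types (u v th psi : seq X -> A) (s : seq X) (l : X -> nat).

Definition cyclic_label l :=
  forall x, (l x < p)%N /\ l (T x) = ((l x).+1 %% p)%N.

Definition trace u s : A := \sum_(i < p) u (map (iter i T) s).

Lemma map_iterS i s : map (iter i.+1 T) s = map (iter i T) (map T s).
Proof. by rewrite -map_comp; apply: eq_map => x; rewrite iterSr. Qed.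

Lemma trace_map u s : trace u (map T s) = trace u s.
Proof.
rewrite /trace; case: p p_gt1 TK => [//|p' _ TK'].
rewrite [LHS]big_ord_recr [RHS]big_ord_recl /= [LHS]addrC; congr (_ + _).
  by rewrite -map_iterS (eq_map TK') !map_id.
by apply: eq_bigr => i _; rewrite -map_iterS.
Qed.

Lemma cobd_trace u : cobd (trace u) =1 trace (cobd u).
Proof.
move=> s; rewrite /trace (cobd_sum (fun i t => u (map (iter i T) t))).
by apply: eq_bigr => i _; rewrite (cobd_map (iter i T)).
Qed.

Lemma eq_trace u v : u =1 v -> trace u =1 trace v.
Proof. by move=> uv s; apply: eq_bigr => i _; rewrite uv. Qed.

Lemma traceD u v s : trace (fun t => u t + v t) s = trace u s + trace v s.
Proof. by rewrite /trace big_split. Qed.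

Lemma trace_sub_map u : trace (fun t => u (map T t) - u t) =1 (fun=> 0).
Proof.
move=> s; rewrite /trace sumrB; apply/eqP; rewrite subr_eq0; apply/eqP.
rewrite -[RHS]/(trace u s) -trace_map; apply: eq_bigr => i _.
by rewrite -map_iterS -map_comp.
Qed.

(* The coboundary of desc l is the pull-back by l of the Bockstein cocycle of
   Z/p; it is invariant although desc l is not. *)
Definition desc l (x y : X) : A := (l y < l x)%N%:R.
Definition top l (x : X) : A := (l x == p.-1)%:R.

(** Alexander-Whitney products with a cochain [c] of degree 0 or 1: front and back faces share a
    vertex, so [u] still receives the last point seen by [c]. *)
Definition cup0 (c : X -> A) u s : A := if s is x :: _ then c x * u s else 0.
Definition cup1 (c : X -> X -> A) u s : A :=
  if s is x :: s' then cup0 (c x) u s' else 0.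

(** Since the product over [ls'] is a cocycle, this coboundary is its cup product with the Bockstein
    cocycle of [l]. The base case is the unit, of degree 0, hence supported on one-point tuples. *)
Fixpoint bockstein_cup (ls : seq (X -> nat)) : seq X -> A :=
  if ls is l :: ls' then cobd (cup1 (desc l) (bockstein_cup ls'))
  else fun s => (size s == 1)%N%:R.

Lemma cobd_bockstein_cup ls : cobd (bockstein_cup ls) =1 (fun=> 0).
Proof.
case: ls => [|l ls] /=; last exact: cobd_cobd.
have cst (a : A) : forall s, cobd (fun t => a *+ (size t == 0)%N) s = a *+ (size s == 1)%N.
  move=> s; case: s => [|x [|y s]] /=; rewrite ?subr0 ?mulr0n//.
  by rewrite cobd0 !subr0.
move=> s; case: s => [//|x s] /=.
rewrite -[X in _ - X]/(cobd (fun t => 1 *+ (size t == 0)%N) s).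
by rewrite cst subrr.
Qed.

Lemma cobd_cup0 c u : cobd u =1 (fun=> 0) ->
  forall x y s, cobd (cup0 c u) (x :: y :: s) = (c y - c x) * u (y :: s).
Proof.
move=> du x y s.
have -> : cobd (cup0 c u) (x :: y :: s) =
    c y * u (y :: s) - cobd (fun t => c x * u (x :: t)) (y :: s) by [].
rewrite cobdM; have /= /eqP := du (x :: y :: s).
by rewrite subr_eq0 /= => /eqP ->; rewrite mulrBl.
Qed.

Lemma cobd_cup1 c u : cobd u =1 (fun=> 0) -> forall x y z s,
  cobd (cup1 c u) (x :: y :: z :: s) = (c y z - c x z + c x y) * u (z :: s).
Proof.
move=> du x y z s.
have -> : cobd (cup1 c u) (x :: y :: z :: s) =
    c y z * u (z :: s) - cobd (cup0 (c x) u) (y :: z :: s) by [].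
by rewrite (cobd_cup0 _ du); ring.
Qed.

Lemma cobd_cup1_short c u s : (size s < 3)%N -> cobd (cup1 c u) s = 0.
Proof. by case: s => [|x [|y []]] //= _; rewrite ?subr0. Qed.

(** By [cobd_cup1] each label contributes a factor comparing its values at three points of the
    tuple; a constant label makes its factor vanish. *)
Lemma bockstein_cup_eq0 ls s l : List.In l ls ->
  (forall x y, List.In x s -> List.In y s -> l x = l y) -> bockstein_cup ls s = 0.
Proof.
elim: ls s => [//|l' ls IH] s.
case: s => [|x [|y [|z s]]]; try by move=> *; rewrite /= ?subr0// cobd_cup1_short.
move=> /= lls ls_cst; rewrite [LHS](cobd_cup1 _ (@cobd_bockstein_cup ls)).
case: lls => [->|lls]; last first.
  rewrite IH ?mulr0// => x' y' xs ys; apply: ls_cst; right; right; done.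
rewrite /desc !(ls_cst _ x); try by [left|right; left|right; right; left].
by rewrite ltnn subrr addr0 mul0r.
Qed.

(** Raising both labels by one keeps their order unless one of them wraps from p - 1 to 0; the
    correction is the coboundary of [top l]. *)
Lemma desc_map l : cyclic_label l ->
  forall x y, desc l (T x) (T y) - desc l x y = top l y - top l x.
Proof.
move=> ll x y; rewrite /desc /top.
have [lxp ->] := ll x; have [lyp ->] := ll y.
have modS m : (m < p)%N -> (m.+1 %% p)%N = if m == p.-1 then 0%N else m.+1.
  move=> mp; case: eqP => [->|/eqP m1].
    by rewrite prednK ?modnn// ltnW.
  by rewrite modn_small//; lia.
rewrite !modS//; have [->|nx] := eqVneq (l x) p.-1.
  have [->|ny] := eqVneq (l y) p.-1; first by rewrite !ltnn !subrr.
  rewrite ltn0; have -> : (l y < p.-1)%N by lia.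
  by rewrite /=; ring.
have [->|ny] := eqVneq (l y) p.-1.
  rewrite ltn0Sn; have -> : (p.-1 < l x)%N = false by lia.
  by rewrite /=; ring.
by rewrite ltnS !subrr.
Qed.

Lemma bockstein_cup_nil ls : bockstein_cup ls [::] = 0.
Proof. by case: ls. Qed.

Lemma bockstein_cup_map ls : (forall l, List.In l ls -> cyclic_label l) ->
  forall s, bockstein_cup ls (map T s) = bockstein_cup ls s.
Proof.
elim: ls => [|l ls IH] ll s /=; first by rewrite size_map.
case: s => [|x [|y [|z s]]]; try by rewrite !cobd_cup1_short.
rewrite !(cobd_cup1 _ (@cobd_bockstein_cup ls)) -!map_cons IH; last first.
  by move=> l' l'ls; apply: ll; right.
congr (_ * _).
have lab := desc_map (ll l (or_introl erefl)).
have e1 a b : desc l (T a) (T b) = desc l a b + (top l b - top l a).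
  by rewrite -lab; ring.
by rewrite !e1; ring.
Qed.

(** First half of a descent step: T - 1 trades [desc l] for [top l], one degree lower. The second
    half, [trace_cup0_top], removes [top l]. *)
Lemma cup1_desc_map l ls : (forall l', List.In l' (l :: ls) -> cyclic_label l') ->
  forall s, cup1 (desc l) (bockstein_cup ls) (map T s) - cup1 (desc l) (bockstein_cup ls) s =
            cobd (cup0 (top l) (bockstein_cup ls)) s.
Proof.
move=> ll [|x [|y s]]; rewrite ?subrr//=; first by rewrite subr0.
have -> : bockstein_cup ls [:: T y & map T s] = bockstein_cup ls (y :: s).
  by rewrite -map_cons bockstein_cup_map// => l' l'ls; apply: ll; right.
rewrite -mulrBl desc_map; last by apply: ll; left.
by rewrite -(cobd_cup0 _ (@cobd_bockstein_cup ls)).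
Qed.

(** Along an orbit the label takes each value modulo p once, so exactly one term is 1. *)
Lemma sum_top l : cyclic_label l -> forall x, \sum_(i < p) top l (iter i T x) = 1.
Proof.
move=> ll x.
have lit i : l (iter i T x) = ((l x + i) %% p)%N.
  elim: i => [|i IH]; first by rewrite addn0 modn_small//; case: (ll x).
  by rewrite iterS (ll _).2 IH -addn1 modnDml -addnA addn1.
have lxp := (ll x).1.
pose i0 := Ordinal (ltn_pmod (p.-1 - l x) (ltnW p_gt1)).
rewrite (bigD1 i0)//= big1 => [|i ii0].
  rewrite /top lit /=.
  have -> : ((l x + (p.-1 - l x) %% p) %% p = p.-1)%N.
    rewrite modnDmr subnKC ?modn_small//; lia.
  by rewrite eqxx addr0.
rewrite /top lit; case: eqP => // E; case/eqP: ii0; apply/val_inj => /=.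
have ip := ltn_ord i.
rewrite modn_small; last lia.
have [h|h] := ltnP (l x + i) p; first by move: E; rewrite modn_small//; lia.
move: E; have -> : (l x + i = p + (l x + i - p))%N by lia.
by rewrite modnDl modn_small; lia.
Qed.

(** The product over [ls] is invariant under [T], so it factors out of the trace and leaves
    [sum_top]. *)
Lemma trace_cup0_top l ls : (forall l', List.In l' (l :: ls) -> cyclic_label l') ->
  trace (cup0 (top l) (bockstein_cup ls)) =1 bockstein_cup ls.
Proof.
move=> ll [|x s]; rewrite /trace; first by rewrite big1// bockstein_cup_nil.
rewrite -[RHS]mul1r -(sum_top (ll l (or_introl erefl)) x) mulr_suml.
apply: eq_bigr => i _ /=; congr (_ * _).
rewrite -map_cons; elim: (i : nat) => [|i' IH].
  by rewrite -[X in bockstein_cup _ X = _]map_id; congr bockstein_cup; rewrite !map_id.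
rewrite (map_comp T) bockstein_cup_map// => l' l'ls; apply: ll; right; exact: l'ls.
Qed.

(* W k u stands for: u vanishes on close tuples of points of the k-th compact
   set. The cocycle bockstein_cup ls is only controlled up to the coboundary of a trace,
   since the primitives provided by the hypothesis are arbitrary. *)
Lemma no_locally_zero_labels (W : nat -> (seq X -> A) -> Prop) (a : X) :
    (forall k u v, u =1 v -> W k u -> W k v) ->
    (forall k, W k (fun=> 0)) ->
    (forall k u v, W k u -> W k v -> W k (fun t => u t + v t)) ->
    (forall k u, W k u -> W k (fun t => - u t)) ->
    (forall u, W 0%N u -> u [:: a] = 0) ->
    (forall k u, cobd u =1 (fun=> 0) -> W k.+1 u ->
      exists2 v, cobd v =1 u & forall i, (i < p)%N -> W k (fun t => v (map (iter i T) t))) ->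
  forall ls, (forall l, List.In l ls -> cyclic_label l) ->
    ~ W (2 * size ls)%N (bockstein_cup ls).
Proof.
move=> Weq W0 WD WN Wa Wprim ls lab Wcup.
suff main : forall g, ~ W (2 * size ls)%N (fun t => bockstein_cup ls t + cobd (trace g) t).
  apply: (main (fun=> 0)); apply: Weq Wcup => t.
  rewrite (eq_cobd (v := fun=> 0)) ?cobd0 ?addr0// => s.
  by rewrite /trace big1.
move=> {Wcup}; elim: ls lab => [|l ls IH] lab g Wg.
  (* At [[:: a]] the unit is 1 and the trace term is p times [g [::]], which is 0 in [A]; so 1 =
     0. *)
  have /eqP := Wa _ Wg; rewrite /= subr0 /trace /=.
  by rewrite sumr_const card_ord -(mulr_natr (g [::])) pA0 mulr0 addr0 oner_eq0.
have lab' l' : List.In l' ls -> cyclic_label l' by move=> ?; apply: lab; right.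
pose c1 := cup1 (desc l) (bockstein_cup ls); pose c0 := cup0 (top l) (bockstein_cup ls).
have mulE : (2 * size (l :: ls) = (2 * size ls).+2)%N by rewrite /=; lia.
rewrite mulE in Wg.
have [|v dv Wv] := Wprim _ _ _ Wg.
  by move=> s; rewrite cobdD !cobd_cobd addr0.
(* [v] and [c1 + trace g] have the same coboundary, so by coning at [a] they differ by a
   coboundary. *)
have [g2 dg2] : exists g2, forall s, v s = c1 s + trace g s + cobd g2 s.
  have cyc : cobd (fun s => v s - (c1 s + trace g s)) =1 (fun=> 0).
    by move=> s; rewrite cobdB cobdD dv subrr.
  exists (fun t => v (a :: t) - (c1 (a :: t) + trace g (a :: t))) => s.
  by rewrite -(cocycle_exact a cyc); ring.
(* T - 1 kills the invariant [trace g] and turns [c1] into the coboundary of [c0], which gives [u1]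
   an explicit primitive to compare with [v']. *)
pose u1 t := v (map T t) - v t.
have u1E : u1 =1 cobd (fun t => c0 t + (g2 (map T t) - g2 t)).
  move=> s; rewrite cobdD -(cup1_desc_map lab) cobdB (cobd_map T) /u1.
  by rewrite !dg2 trace_map /c1; ring.
have [||v' dv' Wv'] := Wprim (2 * size ls)%N u1.
- by move=> s; rewrite (eq_cobd u1E) cobd_cobd.
- apply: WD; first exact: (Wv 1%N).
  apply: WN; apply: Weq (Wv 0%N (ltnW p_gt1)) => t.
  by rewrite (eq_map (g := id))// map_id.
have [g3 dg3] : exists g3, forall s, v' s = c0 s + (g2 (map T s) - g2 s) + cobd g3 s.
  have cyc : cobd (fun s => v' s - (c0 s + (g2 (map T s) - g2 s))) =1 (fun=> 0).
    by move=> s; rewrite cobdB dv' u1E subrr.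
  exists (fun t => v' (a :: t) - (c0 (a :: t) + (g2 (map T (a :: t)) - g2 (a :: t)))) => s.
  by rewrite -(cocycle_exact a cyc); ring.
(* The trace turns [c0] into the product over [ls], kills the difference in [g2], and leaves
   [cobd (trace g3)]: the situation for [ls], with the index of [W] lowered by 2. *)
apply: (IH lab' g3); apply: (Weq _ (trace v')) => [s|].
  rewrite (eq_trace dg3) traceD traceD (trace_cup0_top lab) trace_sub_map.
  by rewrite addr0 cobd_trace.
have : forall m, (m <= p)%N ->
    W (2 * size ls)%N (fun t => \sum_(i < m) v' (map (iter i T) t)).
  elim=> [_|m IHm mp]; first by apply: Weq (W0 _) => t; rewrite big_ord0.
  apply: Weq (WD _ _ _ (IHm (ltnW mp)) (Wv' m mp)) => t.
  by rewrite [RHS]big_ord_recr.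
exact.
Qed.

End Labels.

(** * Labels from invariant equivalence relations *)

Lemma iter_mod_order (X : Type) (p : nat) (T : X -> X) : (forall x, iter p T x = x) ->
  forall m x, iter (m %% p) T x = iter m T x.
Proof.
move=> TK m x; rewrite [in RHS](divn_eq m p) addnC iterD; congr iter.
by elim: (m %/ p)%N => [//|k IH]; rewrite mulSn iterD -IH.
Qed.

(** Fix a base point for each T-orbit of E-classes. Freeness makes the power of [T] that carries it
    into the class of [x] unique modulo p; this power is the label. *)
Lemma cyclic_label_exists (X : Type) (p : nat) (T : X -> X) (E : X -> X -> Prop) :
    (0 < p)%N -> (forall x, iter p T x = x) ->
    (forall x, E x x) -> (forall x y, E x y -> E y x) ->
    (forall x y z, E x y -> E y z -> E x z) ->
    (forall x y, E x y -> E (T x) (T y)) ->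
    (forall i x, (0 < i < p)%N -> ~ E (iter i T x) x) ->
  exists2 l : X -> nat, cyclic_label p T l & forall x y, E x y -> l x = l y.
Proof.
move=> p0 TK Er Es Et ET Efree.
have ETi i x y : E x y -> E (iter i T x) (iter i T y).
  by move=> xy; elim: i => [//|i IH]; exact: ET.
have uniq_lt z x i j : (i < j < p)%N -> E (iter i T z) x -> E (iter j T z) x -> False.
  move=> /andP[ij jp] zi zj; apply: (Efree (j - i)%N (iter i T z)).
    by rewrite subn_gt0 ij (leq_ltn_trans (leq_subr _ _)).
  by rewrite -iterD subnK 1?ltnW//; apply: Et zj (Es _ _ zi).
have uniqE z x i j : (i < p)%N -> (j < p)%N -> E (iter i T z) x -> E (iter j T z) x -> i = j.
  move=> ip jp zi zj; case: (ltngtP i j) => // ij; exfalso.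
    by apply: (@uniq_lt z x i j) => //; rewrite ij.
  by apply: (@uniq_lt z x j i) => //; rewrite ij.
(* The saturated orbit of [x] is the same set for [T x] and for all points related to [x], so a
   choice made from the set gives them a common base point. *)
pose O x : set X := [set z | exists i, E (iter i T z) x].
have OT x : O (T x) = O x.
  apply/seteqP; split=> z [i zi]; last by exists i.+1; exact: ET.
  exists (p.-1 + i)%N; rewrite iterD -(TK x).
  by rewrite -[in X in iter X T x](prednK p0) iterSr; exact: ETi.
have OE x y : E x y -> O x = O y.
  by move=> xy; apply/seteqP; split=> z [i zi]; exists i; [exact: Et xy|exact: Et (Es _ _ xy)].
have [[x0]|nX] := pselect (inhabited X); last by exists (fun=> 0%N) => x; case: nX.
have /choice[c cP] : forall A : set X, exists z, A !=set0 -> A z.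
  by move=> A; have [[z Az]|nA] := pselect (A !=set0); [exists z|exists x0].
have /choice[l lP] : forall x, exists i, (i < p)%N /\ E (iter i T (c (O x))) x.
  move=> x; have [|i xi] := cP (O x); first by exists x, 0%N.
  by exists (i %% p)%N; rewrite ltn_pmod// iter_mod_order.
exists l => [x|x y xy]; have [lx Elx] := lP x.
  split=> //; have [lTx ElTx] := lP (T x).
  apply: (uniqE (c (O x)) (T x)) => //; first by rewrite ltn_pmod.
    by rewrite -(OT x).
  by rewrite iter_mod_order//; exact: ET.
have [ly Ely] := lP y; apply: (uniqE (c (O x)) y) => //; first exact: Et xy.
by rewrite (OE _ _ xy).
Qed.

(** * Shifted grids *)

Section Cells.
Variable R : realType.

(* The shift b is chosen so that t + b/2 is at distance at least 1/4 from every
   integer. *)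
Lemma floor_shift (t : R) : exists b : bool, forall t', `|t - t'| < 1 / 4 ->
  Num.floor (t + b%:R / 2) = Num.floor (t' + b%:R / 2).
Proof.
have := floor_itv t; set m := Num.floor t; rewrite intrD => /andP[mt tm].
have stable (b : bool) (k : int) :
    k%:~R + 1 / 4 <= t + b%:R / 2 -> t + b%:R / 2 < k%:~R + 3 / 4 ->
    forall t', `|t - t'| < 1 / 4 -> Num.floor (t + b%:R / 2) = Num.floor (t' + b%:R / 2).
  move=> k1 k2 t'; rewrite ltr_norml => /andP[t1 t2].
  by rewrite !(@floor_def _ _ k)// intrD; apply/andP; split; lra.
have [t1|t1] := ltP t (m%:~R + 1 / 4).
  by exists true; apply: (stable _ m) => /=; lra.
have [t3|t3] := ltP t (m%:~R + 3 / 4).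
  by exists false; apply: (stable _ m) => /=; lra.
by exists true; apply: (stable _ (m + 1)); rewrite intrD /=; lra.
Qed.

Variable n : nat.
Implicit Types (z : 'rV[R]_n) (c : {ffun 'I_n -> bool}).

Definition cell (w : R) c z : 'I_n -> int :=
  fun i => Num.floor (z ord0 i / w + (c i)%:R / 2).

Lemma ler_coord_norm z i : `|z ord0 i| <= `|z|.
Proof.
by rewrite [leRHS]/Num.norm /= mx_normrE; apply/bigmax_geP; right => /=; exists (ord0, i).
Qed.

Lemma ler_norm_coord z (e : R) : 0 <= e -> (forall i, `|z ord0 i| <= e) -> `|z| <= e.
Proof.
move=> e0 ze; rewrite [leLHS]/Num.norm /= mx_normrE; apply/bigmax_leP; split=> // -[j i] _ /=.
by rewrite ord1.
Qed.

(** The shift is chosen coordinate by coordinate from [z] alone; dividing by [w] turns the margin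
    w/4 into the 1/4 of [floor_shift]. *)
Lemma cell_shift w z : 0 < w ->
  exists c, forall z', `|z - z'| < w / 4 -> cell w c z = cell w c z'.
Proof.
move=> w0; have /choice[b bP] := fun i => floor_shift (z ord0 i / w).
exists [ffun i => b i] => z' zz'; apply/funext => i; rewrite /cell ffunE; apply: bP.
rewrite -mulrBl normrM normfV (gtr0_norm w0) ltr_pdivrMr//.
apply: le_lt_trans (_ : `|z - z'| < _); last by rewrite mul1r mulrC.
by apply: le_trans (ler_coord_norm _ i); rewrite !mxE.
Qed.

Lemma cell_small w c z z' : 0 < w -> cell w c z = cell w c z' -> `|z - z'| <= w.
Proof.
move=> w0 zz'; apply: ler_norm_coord => [|i]; first exact: ltW.
have := congr1 (fun h => h i) zz'; rewrite /cell => E.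
have := floor_itv (z' ord0 i / w + (c i)%:R / 2).
have := floor_itv (z ord0 i / w + (c i)%:R / 2).
rewrite E; set k := Num.floor _; rewrite intrD => /andP[h1 h2] /andP[h3 h4].
have : `|z ord0 i / w - z' ord0 i / w| <= 1 by rewrite ler_norml; apply/andP; split; lra.
by rewrite -mulrBl normrM normfV (gtr0_norm w0) ler_pdivrMr// mul1r !mxE.
Qed.

End Cells.

(** * Lifts of a proper local homeomorphism through itself *)

(** [P] holds at once for all points near [x] and all small parameters, which is what the
    near-covering form of compactness asks. *)
Lemma compact_uniform (R : realType) (V : normedModType R) (C : set V)
    (P : V -> R -> Prop) : compact C ->
    (forall x, C x -> exists2 d, 0 < d &
      forall y e, `|x - y| < d -> 0 < e < d -> P y e) ->
  exists2 e, 0 < e & forall x, C x -> P x e.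
Proof.
move=> /compact_near_coveringP Cc CP.
have : \forall e \near 0^'+, C `<=` fun x => P x e.
  apply: Cc => x /CP [d d0 xP].
  exists (ball x d, [set e | 0 < e < d]) => /=.
    split; first exact: nbhsx_ballx.
    by near=> e; apply/andP; split; near: e; [exact: nbhs_right_gt|exact: nbhs_right_lt].
  by case=> y e [] /=; rewrite -ball_normE /=; exact: xP.
move=> H; have [e [e0 He]] : exists e : R, 0 < e /\ C `<=` fun x => P x e.
  near (0:R)^'+ => e; exists e; split; first by near: e; exact: nbhs_right_gt.
  by near: e.
by exists e.
Unshelve. all: by end_near. Qed.

(** The truth value of [P] is locally constant, so [P] cuts out a nonempty clopen subset of the
    segment. *)
Lemma unit_interval_connected (R : realType) (P : R -> Prop) :
    (forall t : R, 0 <= t <= 1 -> exists2 d : R, 0 < d &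
      (forall t', `|t - t'| < d -> P t') \/ (forall t', `|t - t'| < d -> ~ P t')) ->
  P 0 -> P 1.
Proof.
move=> H P0.
pose O1 : set R := interior P; pose O2 : set R := interior (~` P).
have O1o : open O1 by exact: open_interior.
have O2o : open O2 by exact: open_interior.
have itvE t : (`[0, 1]%classic : set R) t = (0 <= t <= 1) by rewrite /= in_itv.
have dich t : 0 <= t <= 1 -> O1 t \/ O2 t.
  move=> /H[d d0 [h|h]]; [left|right]; apply/nbhs_ballP; exists d => //= t';
  by rewrite -ball_normE; exact: h.
have O1P t : O1 t -> P t by move=> /nbhs_singleton.
have O2P t : O2 t -> ~ P t by move=> /nbhs_singleton.
have : `[0, 1] `&` O1 = `[0, 1]%classic.
  apply: (@segment_connected R 0 1).
  - exists 0; split; first by rewrite itvE lexx ler01.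
    have [|//|/O2P] := dich 0; first by rewrite lexx ler01.
    by [].
  - by exists O1.
  - exists (~` O2); first exact: open_closedC.
    apply/seteqP; split=> t [t01 Ot]; split=> //.
      by move=> /O2P; apply; exact: O1P.
    by move: t01; rewrite itvE => /dich[].
move=> /seteqP[_ /(_ 1)]; rewrite itvE lexx ler01 => /(_ isT)[_ /O1P]; exact.
Qed.

Section Deck.
Variables (R : realType) (V : normedModType R) (n : nat).
Variables (q : V -> R) (f : V -> 'rV[R]_n).

Definition cts_at (W W' : normedModType R) (g : W -> W') x :=
  forall e : R, 0 < e -> exists2 d, 0 < d & forall y, `|x - y| < d -> `|g x - g y| < e.

Definition seg (a x : V) (t : R) := a + t *: (x - a).

Lemma seg0 a x : seg a x 0 = a. Proof. by rewrite /seg scale0r addr0. Qed.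
Lemma seg1 a x : seg a x 1 = x. Proof. by rewrite /seg scale1r addrC subrK. Qed.
Lemma segxx a t : seg a a t = a. Proof. by rewrite /seg subrr scaler0 addr0. Qed.
Lemma seg_distl a x t t' : `|seg a x t - seg a x t'| = `|t - t'| * `|x - a|.
Proof. by rewrite /seg opprD addrACA subrr add0r -scalerBl normrZ. Qed.
Lemma seg_distr a x y t : `|seg a x t - seg a y t| = `|t| * `|x - y|.
Proof.
rewrite /seg opprD addrACA subrr add0r -scalerBr normrZ.
by rewrite opprB addrA subrK.
Qed.

(** The ball enters only through an exhaustion [q], quasiconvex along segments and with compact
    sublevel sets below level 1. *)
Let D x := q x < 1.
Hypothesis q_cts : forall x, cts_at (W' := R) q x.
Hypothesis q_seg : forall a x t, 0 <= t <= 1 -> q (seg a x t) <= Num.max (q a) (q x).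
Hypothesis q_compact : forall r, r < 1 -> compact [set x | q x <= r].
Hypothesis f_cts : forall x, D x -> cts_at f x.
Hypothesis f_open : forall x, D x -> forall s, 0 < s -> exists2 e, 0 < e &
  forall z, `|f x - z| < e -> exists y, [/\ `|x - y| < s, D y & f y = z].
Hypothesis f_inj : forall x, D x -> exists2 r, 0 < r &
  forall y z, `|x - y| < r -> `|x - z| < r -> f y = f z -> y = z.
Hypothesis f_proper : forall C : set V, compact C -> (forall x, C x -> D x) ->
  compact [set x | D x /\ exists2 y, C y & f y = f x].

Lemma q_lt x r : q x < r -> exists2 d, 0 < d & forall y, `|x - y| < d -> q y < r.
Proof.
move=> qr; have [|d d0 xd] := @q_cts x (r - q x); first by rewrite subr_gt0.
by exists d => // y /xd; rewrite distrC ltr_norml => /andP[_]; rewrite ltrBlDr subrK.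
Qed.

Lemma ltr_dist_halves (W : normedModType R) (x y z : W) (e : R) :
  `|x - y| < e / 2 -> `|y - z| < e / 2 -> `|x - z| < e.
Proof. by move=> xy yz; rewrite (splitr e) (le_lt_trans (ler_distD y _ _))// ltrD. Qed.

Lemma unif_inj C : compact C -> (forall x, C x -> D x) -> exists2 r, 0 < r &
  forall x, C x -> forall y z, `|x - y| < r -> `|x - z| < r -> f y = f z -> y = z.
Proof.
move=> Cc CD; apply: compact_uniform => // x /CD /f_inj[r r0 xr].
exists (r / 2); first by rewrite divr_gt0.
move=> y e xy /andP[e0 er] z z' yz yz'.
by apply: xr; apply: ltr_dist_halves xy _; apply: lt_trans er.
Qed.

Lemma unif_open C : compact C -> (forall x, C x -> D x) -> forall s, 0 < s ->
  exists2 e, 0 < e & forall x, C x -> forall z, `|f x - z| < e ->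
    exists y, [/\ `|x - y| < s, D y & f y = z].
Proof.
move=> Cc CD s s0; apply: compact_uniform => // x /CD Dx.
have [|e e0 xe] := f_open Dx (s := s / 2); first by rewrite divr_gt0.
have [|d d0 xd] := f_cts Dx (e := e / 2); first by rewrite divr_gt0.
exists (Num.min d (Num.min (s / 2) (e / 2))); first by rewrite !lt_min d0 !divr_gt0.
move=> y e'; rewrite !lt_min => /andP[yd /andP[ys ye]] /andP[e'0] /andP[_ /andP[_ e'e]] z yz.
have [|y' [xy' Dy' fy']] := xe z.
  by apply: ltr_dist_halves (xd _ yd) _; apply: lt_trans e'e.
exists y'; split=> //; apply: ltr_dist_halves xy'.
by rewrite distrC.
Qed.

Lemma unif_cts (W : normedModType R) (g : V -> W) C : compact C ->
    (forall x, C x -> cts_at g x) -> forall s, 0 < s ->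
  exists2 e, 0 < e & forall x, C x -> forall y, `|x - y| < e -> `|g x - g y| < s.
Proof.
move=> Cc Cg s s0; apply: compact_uniform => // x /Cg gx.
have [|d d0 xd] := gx (s / 2); first by rewrite divr_gt0.
exists (d / 2); first by rewrite divr_gt0.
move=> y e yd /andP[e0 ed] z yz; apply: (@ltr_dist_halves _ _ (g x)).
  rewrite distrC; apply: xd; apply: lt_trans yd _.
  by rewrite ltr_pdivrMr// ltr_pMr// ltr1n.
by apply: xd; apply: ltr_dist_halves yd (lt_trans yz ed).
Qed.

Definition lift_on r g := forall x, q x < r -> [/\ D (g x), f (g x) = f x & cts_at g x].

Lemma lift_on_le r r' g : r' <= r -> lift_on r g -> lift_on r' g.
Proof. by move=> rr' gl x xr'; apply: gl; apply: lt_le_trans rr'. Qed.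

Lemma q_seg_lt a x t r : 0 <= t <= 1 -> q a < r -> q x < r -> q (seg a x t) < r.
Proof. by move=> t01 ar xr; rewrite (le_lt_trans (q_seg _ _ t01))// gt_max ar. Qed.

Lemma dist_neq_gt0 (W : normedModType R) (x y : W) : x <> y -> 0 < `|x - y|.
Proof. by move=> xy; rewrite normr_gt0 subr_eq0; apply/eqP. Qed.

Lemma cts_comp_seg (W : normedModType R) (g : V -> W) a x t : cts_at g (seg a x t) ->
  cts_at (W := R) (fun t => g (seg a x t)) t.
Proof.
move=> gc e /gc[d d0 gd]; exists (d / (`|x - a| + 1)).
  by rewrite divr_gt0// ltr_wpDl.
move=> t' tt'; apply: gd; rewrite seg_distl.
apply: le_lt_trans (_ : `|t - t'| * (`|x - a| + 1) < d).
  by rewrite ler_wpM2l// lerDl.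
by rewrite -ltr_pdivlMr// ltr_wpDl.
Qed.

(** Along the segment from [a], agreement is an open condition by local injectivity of [f] at the
    common value, and disagreement is open by continuity. *)
Lemma lift_unique r g g' a : r <= 1 -> lift_on r g -> lift_on r g' ->
  q a < r -> g a = g' a -> forall x, q x < r -> g x = g' x.
Proof.
move=> r1 gl gl' ar gg'a x xr; rewrite -(seg1 a x).
apply: (@unit_interval_connected R (fun t => g (seg a x t) = g' (seg a x t))); last first.
  by rewrite seg0.
move=> t t01; have qt := q_seg_lt t01 ar xr.
have [Dg fg gc] := gl _ qt; have [Dg' fg' gc'] := gl' _ qt.
have cg := cts_comp_seg gc; have cg' := cts_comp_seg gc'.
have [qd qd0 qdP] := q_lt qt.
have [E|/dist_neq_gt0 E] := pselect (g (seg a x t) = g' (seg a x t)).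
  have [s s0 sP] := f_inj Dg.
  have [d d0 dP] := cg s s0; have [d' d'0 dP'] := cg' s s0.
  (* The parameter may leave [0, 1] slightly, so membership in the sublevel set is obtained from
     continuity of [q]. *)
  have [d2 d20 dP2] : exists2 d, 0 < d & forall t', `|t - t'| < d -> q (seg a x t') < r.
    have [|d2 d20 dP2] := @cts_comp_seg R q a x t (@q_cts _) (r - q (seg a x t)).
      by rewrite subr_gt0.
    exists d2 => // y /dP2; rewrite distrC ltr_norml => /andP[_].
    by rewrite ltrBlDr subrK.
  exists (Num.min d (Num.min d' d2)); first by rewrite !lt_min d0 d'0 d20.
  left=> t'; rewrite !lt_min => /andP[td /andP[td' td2]].
  have [_ e _] := gl _ (dP2 _ td2); have [_ e' _] := gl' _ (dP2 _ td2).
  apply: sP; [exact: dP| |by rewrite e e'].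
  by rewrite E; apply: dP'.
have E2 : 0 < `|g (seg a x t) - g' (seg a x t)| / 2 by rewrite divr_gt0.
have [d d0 dP] := cg _ E2; have [d' d'0 dP'] := cg' _ E2.
exists (Num.min d d'); first by rewrite lt_min d0.
right=> t'; rewrite lt_min => /andP[/dP td /dP' td'] e.
rewrite e in td.
have : `|g (seg a x t) - g' (seg a x t)| < `|g (seg a x t) - g' (seg a x t)|.
  by apply: ltr_dist_halves td _; rewrite distrC.
by rewrite ltxx.
Qed.

Lemma sublevel_bounded r a : r < 1 ->
  exists2 M : R, 0 < M & forall x, q x <= r -> `|x - a| <= M.
Proof.
move=> r1; have [M [Mr MP]] := @compact_bounded R V _ (q_compact r1).
exists (`|M| + 1 + `|a|); first by rewrite -addrA ltr_wpDl// ltr_pwDl.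
move=> x xr; rewrite (le_trans (ler_normB _ _))// lerD2r; apply: MP => //.
by rewrite (le_lt_trans (ler_norm _))// ltrDl.
Qed.

(* The segments from a to the points of the sublevel set are cut into L pieces,
   and a lift of the j-th contraction h j is corrected to a lift of h j.+1. *)
Lemma lift_exists_on r a b : r < 1 -> q a < r -> D b -> f a = f b ->
  exists2 g, lift_on r g & g a = b.
Proof.
move=> r1 ar Db fab; pose K := [set x | q x <= r]; have Kc := q_compact r1.
have KD x : K x -> D x by move=> /le_lt_trans; apply.
(* Every lift over [K] takes its values in this compact saturation, so the constants below serve all
   steps [j]. *)
pose C := [set x | D x /\ exists2 y, K y & f y = f x].
have Cc : compact C by exact: f_proper.
have CD x : C x -> D x by case.
have [s s0 Cs] := unif_inj Cc CD.
have s30 : 0 < s / 3 by rewrite divr_gt0.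
have [e e0 Ce] := unif_open Cc CD s30.
have [d d0 Kd] := unif_cts Kc (fun x Kx => f_cts (KD x Kx)) e0.
have [M M0 KM] := sublevel_bounded a r1.
(* With this many pieces each one is shorter than [d], as the segments have length at most [M]. *)
pose L := (Num.truncn (M / d)).+1.
have L0 : 0 < L%:R :> R by rewrite ltr0n.
pose h j x := seg a x (j%:R / L%:R).
have hK j x : (j <= L)%N -> q x < r -> K (h j x).
  move=> jL xr; apply/ltW/q_seg_lt => //.
  by rewrite divr_ge0//= ler_pdivrMr// mul1r ler_nat.
have ha j : h j a = a by exact: segxx.
have hS j x : q x < r -> `|h j x - h j.+1 x| < d.
  move=> xr; rewrite seg_distl distrC -mulrBl -natrB// subSnn.
  rewrite mul1r ger0_norm ?invr_ge0 ?ler0n// mulrC ltr_pdivrMr//.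
  apply: le_lt_trans (KM _ (ltW xr)) _; rewrite mulrC -ltr_pdivrMr//.
  exact: truncnS_gt.
suff : forall j, (j <= L)%N -> exists2 g : V -> V, g a = b &
    forall x, q x < r -> [/\ D (g x), f (g x) = f (h j x) & cts_at g x].
  move=> /(_ L (leqnn L))[g ga gl]; exists g => // x /gl[Dg fg gc]; split => //.
  by rewrite fg /h divff ?seg1// gt_eqF.
elim=> [_|j IH jL].
  exists (fun=> b) => // x xr; split=> //; first by rewrite /h mul0r seg0.
  by move=> e' e'0; exists 1 => // y _; rewrite subrr normr0.
have [g ga gl] := IH (ltnW jL).
have gC x : q x < r -> C (g x).
  move=> xr; have [Dg fg _] := gl _ xr; split => //.
  by exists (h j x) => //; apply: hK => //; apply: ltnW.
(* The corrected value is found near [g x] by uniform openness; local injectivity then forces its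
   value at [a] and its continuity. *)
have : forall x, exists y, q x < r -> [/\ `|g x - y| < s / 3, D y & f y = f (h j.+1 x)].
  move=> x; have [xr|xr] := pselect (q x < r); last by exists x => /xr.
  have [|y yP] := Ce _ (gC _ xr) (f (h j.+1 x)); last by exists y.
  have [_ -> _] := gl _ xr; apply: Kd; last exact: hS.
  by apply: hK => //; apply: ltnW.
move=> /choice[g' gl'].
have s3s : s / 3 < s by rewrite ltr_pdivrMr// ltr_pMr// ltr1n.
exists g'.
  have [gd Dg' fg'] := gl' _ ar.
  apply/esym/(Cs b); rewrite ?subrr ?normr0//.
  - by split=> //; exists a => //; exact: ltW.
  - by rewrite -ga; apply: lt_trans s3s.
  - by rewrite fg' ha.
move=> x xr; have [gd Dg' fg'] := gl' _ xr; split => // e1 e10.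
have g'C : C (g' x) by split=> //; exists (h j.+1 x); [exact: hK|].
have [|e2 e20 e2P] := f_open Dg' (s := Num.min e1 s); first by rewrite lt_min e10.
have [d1 d10 d1P] := q_lt xr.
have [_ _ gc] := gl _ xr.
have [d2 d20 d2P] := gc _ s30.
have [d3 d30 d3P] := f_cts (KD _ (hK j.+1 x jL xr)) e20.
exists (Num.min d1 (Num.min d2 d3)); first by rewrite !lt_min d10 d20 d30.
move=> y; rewrite !lt_min => /andP[yd1 /andP[yd2 yd3]].
have yr := d1P _ yd1; have [gdy Dg'y fg'y] := gl' _ yr.
have [|y2 [+ Dy2 fy2]] := e2P (f (h j.+1 y)).
  rewrite fg'; apply: d3P; rewrite seg_distr ger0_norm ?divr_ge0 ?ler0n//.
  apply: le_lt_trans yd3; rewrite ler_piMl//.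
  by rewrite ler_pdivrMr// mul1r ler_nat.
rewrite lt_min => /andP[y2e y2s].
(* Both points lie over [f (h j.+1 y)] and within [s] of [g' x]. For [g' y] the three thirds are the
   two corrections and the variation of [g]. *)
suff -> : g' y = y2 by [].
apply: (Cs _ g'C) => //; last by rewrite fg'y fy2.
have -> : s = s / 3 + s / 3 + s / 3 by field.
apply: le_lt_trans (ler_distD (g y) _ _) _; rewrite ltrD//.
apply: le_lt_trans (ler_distD (g x) _ _) _; rewrite ltrD//; last exact: d2P.
by rewrite distrC.
Qed.

(** Lifts on different sublevel sets agree by uniqueness. They are glued by using, at [x], the level
    [rho x] halfway between the larger of [q a], [q x] and 1. *)
Lemma lift_exists a b : D a -> D b -> f a = f b ->
  exists2 g, lift_on 1 g & g a = b.
Proof.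
move=> Da Db fab.
have : forall r, exists g : V -> V, q a < r < 1 -> lift_on r g /\ g a = b.
  move=> r; have [/andP[ar r1]|nr] := boolP (q a < r < 1); last by exists id.
  by have [g gl ga] := lift_exists_on r1 ar Db fab; exists g.
move=> /choice[G GP].
have GG r r' x : q a < r < 1 -> q a < r' < 1 -> q x < r -> q x < r' -> G r x = G r' x.
  move=> r1 r1' xr xr'; have [gl ga] := GP _ r1; have [gl' ga'] := GP _ r1'.
  apply: (@lift_unique (Num.min r r') _ _ a).
  - by rewrite ge_min; case/andP: r1 => _ /ltW ->.
  - by apply: lift_on_le gl; rewrite ge_min lexx.
  - by apply: lift_on_le gl'; rewrite ge_min lexx orbT.
  - by rewrite lt_min; case/andP: r1 => ->; case/andP: r1' => ->.
  - by rewrite ga ga'.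
  - by rewrite lt_min xr.
pose rho x := (Num.max (q a) (q x) + 1) / 2.
have m1 x : D x -> Num.max (q a) (q x) < 1.
  by move=> Dx; rewrite gt_max; apply/andP.
have rhoP x : D x -> q a < rho x < 1.
  move=> /m1 m1x; have : q a <= Num.max (q a) (q x) by rewrite le_max lexx.
  by rewrite /rho => h; apply/andP; split; lra.
have rhoq x : D x -> q x < rho x.
  move=> /m1 m1x; have : q x <= Num.max (q a) (q x) by rewrite le_max lexx orbT.
  by rewrite /rho => h; lra.
exists (fun x => G (rho x) x); last by have [] := GP _ (rhoP _ Da).
move=> x Dx; have [gl _] := GP _ (rhoP _ Dx).
have [Dg fg gc] := gl _ (rhoq _ Dx); split=> // e /gc[d d0 dP].
have [d1 d10 d1P] := q_lt (rhoq _ Dx).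
exists (Num.min d d1); first by rewrite lt_min d0.
move=> y; rewrite lt_min => /andP[yd /d1P yd1].
have Dy : D y by apply: lt_trans yd1 _; case/andP: (rhoP _ Dx).
rewrite -(GG (rho x) (rho y) y) ?rhoP ?rhoq//.
exact: dP.
Qed.

Lemma lift_comp g g' : lift_on 1 g -> lift_on 1 g' -> lift_on 1 (g \o g').
Proof.
move=> gl gl' x Dx; have [Dg' fg' gc'] := gl' _ Dx; have [Dg fg gc] := gl _ Dg'.
split=> //=; first by rewrite fg fg'.
by move=> e /gc[d /gc'[d' d'0 h] h']; exists d' => // y /h /h'.
Qed.

Lemma lift_id : lift_on 1 id.
Proof. by move=> x Dx; split=> // e e0; exists e. Qed.

Lemma lift_iter g i : lift_on 1 g -> lift_on 1 (iter i g).
Proof. by move=> gl; elim: i => [|i IH]; [exact: lift_id|exact: lift_comp]. Qed.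

(** The orbit of [a] lies in a compact fibre, so two iterates come within an injectivity radius of a
    cluster point and coincide. By uniqueness of lifts a power with a fixed point is the identity; p
    is the least such positive exponent. *)
Lemma finite_order_lift a b : D a -> D b -> f a = f b -> a <> b ->
  exists (p : nat) (g : V -> V), [/\ (1 < p)%N, lift_on 1 g,
    forall x, D x -> iter p g x = x &
    forall i x, (0 < i < p)%N -> D x -> iter i g x <> x].
Proof.
move=> Da Db fab ab; have [g gl ga] := lift_exists Da Db fab.
have gi i := lift_iter i gl.
have fixid i x : D x -> iter i g x = x -> forall y, D y -> iter i g y = y.
  by move=> Dx ix y Dy; apply: (lift_unique (lexx 1) (gi i) lift_id Dx).
pose C := [set x | D x /\ exists2 y, [set a] y & f y = f x].
have Cc : compact C by apply: f_proper; [exact: compact_set1|move=> x ->].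
have [s s0 Cs] := unif_inj Cc (fun x (Cx : C x) => Cx.1).
have uC i : C (iter i g a).
  by have [Dg fg _] := gi i _ Da; split=> //; exists a.
have [z [Cz zP]] : C `&` cluster ((fun i => iter i g a) @ \oo) !=set0.
  by apply: Cc; exists 0%N => // i _; exact: uC.
have often N : exists2 i, (N <= i)%N & `|z - iter i g a| < s.
  have [||y [[i Ni <-]]] := zP [set y | exists2 i, (N <= i)%N & iter i g a = y] (ball z s).
  - by exists N => // i Ni; exists i.
  - exact: nbhsx_ballx.
  - by rewrite -ball_normE; exists i.
have [i _ zi] := often 0%N; have [j ij zj] := often i.+1.
have E : iter i g a = iter j g a.
  apply: (Cs z) => //.
  by have [_ -> _] := gi i _ Da; have [_ -> _] := gi j _ Da.
have ex : exists m, (0 < m)%N && `[< forall x, D x -> iter m g x = x >].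
  exists (j - i)%N; rewrite subn_gt0 ij; apply/asboolP.
  apply: (fixid _ (iter i g a)); first by have [] := gi i _ Da.
  by rewrite -iterD subnK// ltnW.
case: (ex_minnP ex) => p /andP[p0 /asboolP gp] pmin.
exists p, g; split=> //.
  rewrite ltn_neqAle p0 andbT; apply/eqP => p1; apply: ab.
  by rewrite -ga -[LHS](gp _ Da) -p1.
move=> k x /andP[k0 kp] Dx kx.
have : (p <= k)%N by apply: pmin; rewrite k0; apply/asboolP; exact: fixid kx.
by rewrite leqNgt kp.
Qed.

Notation X := {x : V | q x < 1}.

(** * Free cyclic actions on the ball *)

Definition small (r e : R) (s : seq X) :=
  (forall x, List.In x s -> q (val x) <= r) /\
  (forall x y, List.In x s -> List.In y s -> `|val x - val y| < e).

(** These are the cochains divided out in Alexander-Spanier cohomology, here over the compact set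
    where [q] is at most [r]. *)
Definition locally_zero (A : comNzRingType) r (u : seq X -> A) :=
  exists2 e, 0 < e & forall s, small r e s -> u s = 0.

Lemma small_le r e e' s : e <= e' -> small r e s -> small r e' s.
Proof. by move=> ee' [sr se]; split=> // x y xs ys; apply: lt_le_trans ee'; exact: se. Qed.

(** The cone at [a] would not be locally zero, since [a] may be far from the tuple. The contraction
    to [a] is therefore cut into short steps and their prisms are added; the constant tuple at its
    end is small, so [u] vanishes there. *)
Lemma locally_zero_primitive (A : comNzRingType) r a (u : seq X -> A) :
    r < 1 -> q a <= r -> cobd u =1 (fun=> 0) -> locally_zero r u ->
  exists2 v, cobd v =1 u & locally_zero r v.
Proof.
move=> r1 ar du [e e0 ue].
have e30 : 0 < e / 3 by rewrite divr_gt0.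
have [M M0 rM] := sublevel_bounded a r1.
pose L := (Num.truncn (M / (e / 3))).+1.
have L0 : 0 < L%:R :> R by rewrite ltr0n.
have Mle : M / L%:R < e / 3.
  by rewrite ltr_pdivrMr// mulrC -ltr_pdivrMr// truncnS_gt.
(* For [j <= L] the point stays in the domain, so [insubd] does not fall back on its default; this
   is [hval]. *)
pose h j (x : X) : X := insubd x (seg a (val x) (j%:R / L%:R)).
have t01 j : (j <= L)%N -> 0 <= (j%:R / L%:R : R) <= 1.
  by move=> jL; rewrite divr_ge0//= ler_pdivrMr// mul1r ler_nat.
have hval j x : (j <= L)%N -> val (h j x) = seg a (val x) (j%:R / L%:R).
  move=> jL; rewrite val_insubd ifT//.
  by apply: q_seg_lt (t01 _ jL) _ (valP x); apply: le_lt_trans r1.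
have hr j x : (j <= L)%N -> q (val x) <= r -> q (val (h j x)) <= r.
  move=> jL xr; rewrite hval//; apply: le_trans (q_seg _ _ (t01 _ jL)) _.
  by rewrite ge_max ar.
have hxx j (x y : X) : (j <= L)%N -> `|val (h j x) - val (h j y)| <= `|val x - val y|.
  move=> jL; rewrite !hval// seg_distr ler_piMl// ger0_norm; by case/andP: (t01 j jL).
have hS j x : (j < L)%N -> q (val x) <= r -> `|val (h j x) - val (h j.+1 x)| < e / 3.
  move=> jL xr; rewrite !hval// 1?ltnW// seg_distl distrC -mulrBl -natrB// subSnn.
  rewrite mul1r ger0_norm ?invr_ge0 ?ler0n// mulrC; apply: le_lt_trans Mle.
  by rewrite ler_pM2r ?invr_gt0// rM.
exists (fun s => \sum_(j < L) prism (h j) (h j.+1) u s) => [s|].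
  rewrite telescope_prism//.
  have -> : map (h L) s = s.
    rewrite -[RHS]map_id; apply: eq_map => x; apply: val_inj.
    by rewrite hval// divff ?seg1// gt_eqF.
  rewrite [X in _ - X]ue ?subr0//; split=> [x|x y] /List.in_map_iff[x' [<- _]].
    by rewrite hval// mul0r seg0.
  by move=> /List.in_map_iff[y' [<- _]]; rewrite !hval// mul0r !seg0 subrr normr0.
exists (e / 3) => // s [sr se]; rewrite big1// => -[j jL] _ /=.
apply: (prism_eq0 (B := fun y => exists2 x, List.In x s & y = h j x \/ y = h j.+1 x)).
- move=> t tB; apply: ue.
  have near x y : List.In x s -> y = h j x \/ y = h j.+1 x ->
      `|val y - val (h j x)| < e / 3.
    move=> xs [->|->]; first by rewrite subrr normr0.
    by rewrite distrC hS//; exact: sr.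
  split=> [y /tB[x /sr xr [->|->]]|y y' /tB[x xs xy] /tB[x' xs' xy']].
  + by apply: hr => //; exact: ltnW.
  + exact: hr.
  (* The thirds are one contraction step at each end and, in the middle, the distance in the
     original tuple, which contraction does not increase. *)
  have -> : e = e / 3 + e / 3 + e / 3 by field.
  apply: le_lt_trans (ler_distD (val (h j x')) _ _) _; rewrite ltrD//.
    apply: le_lt_trans (ler_distD (val (h j x)) _ _) _; rewrite ltrD//; first exact: near.
    by apply: le_lt_trans (hxx _ _ _ (ltnW jL)) _; exact: se.
  by rewrite distrC; exact: near.
- by move=> x xs; split; exists x => //; [left|right].
Qed.

(** On a compact sublevel set [q] of each iterate is continuous and below 1, hence bounded away from
    1. *)
Lemma radius_iter g m r : lift_on 1 g -> r < 1 -> exists r', [/\ r <= r', r' < 1 &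
  forall i x, (i < m)%N -> q x <= r -> q (iter i g x) <= r'].
Proof.
move=> gl r1; elim: m => [|m [r' [rr' r'1 IH]]]; first by exists r.
have Kc := q_compact r1; have gm := lift_iter m gl.
have [|e e0 eP] := compact_uniform (P := fun x e => q (iter m g x) <= 1 - e) Kc.
  move=> x /= xr; have [Dg _ gc] := gm x (le_lt_trans xr r1).
  have e0 : 0 < (1 - q (iter m g x)) / 2 by rewrite divr_gt0// subr_gt0.
  have [d d0 dP] := q_lt (ltac:(lra) : q (iter m g x) < 1 - (1 - q (iter m g x)) / 2).
  have [d' d'0 dP'] := gc _ d0.
  exists (Num.min d' ((1 - q (iter m g x)) / 2)); first by rewrite lt_min d'0.
  move=> y e; rewrite !lt_min => /andP[/dP' /dP + _] /andP[_ /andP[_]].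
  by lra.
exists (Num.max r' (1 - e)); split.
- by rewrite le_max rr'.
- by rewrite gt_max r'1 /=; lra.
- move=> i x; rewrite ltnS leq_eqVlt => /predU1P[->|im] xr.
    by rewrite le_max eP ?orbT.
  by rewrite le_max IH.
Qed.

(** The lift has finite order only on the domain, while the cochain argument needs a map of a type
    to itself. *)
Definition lift_sub g (gl : lift_on 1 g) (x : X) : X :=
  exist _ (g (val x)) (let: And3 Dg _ _ := gl _ (valP x) in Dg).

Lemma val_iter_lift_sub g (gl : lift_on 1 g) i x :
  val (iter i (lift_sub gl) x) = iter i g (val x).
Proof. by elim: i => [//|i /= ->]. Qed.

Lemma locally_zero_lift (A : comNzRingType) g (gl : lift_on 1 g) i r r' (u : seq X -> A) :
    r < 1 -> (forall x, q x <= r -> q (iter i g x) <= r') -> locally_zero r' u ->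
  locally_zero r (fun s => u (map (iter i (lift_sub gl)) s)).
Proof.
move=> r1 rr' [e e0 ue]; have gi := lift_iter i gl.
have [|d d0 dP] := unif_cts (q_compact r1) (g := iter i g) _ e0.
  by move=> x /= xr; have [] := gi x (le_lt_trans xr r1).
exists d => // s [sr se]; apply: ue; split=> [x|x y] /List.in_map_iff[x' [<- xs]].
  by rewrite val_iter_lift_sub; apply: rr'; exact: sr.
move=> /List.in_map_iff[y' [<- ys]]; rewrite !val_iter_lift_sub.
by apply: dP => /=; [exact: sr|exact: se].
Qed.

(** For each grid, nearby points with images in the same cell are identified; this relation is
    invariant and free, so it yields a label. A small tuple has its image in one cell of a suitable
    grid. *)
Lemma lift_labels p g (gl : lift_on 1 g) r : (0 < p)%N ->
    (forall x, D x -> iter p g x = x) ->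
    (forall i x, (0 < i < p)%N -> D x -> iter i g x <> x) -> r < 1 ->
  exists2 l : {ffun 'I_n -> bool} -> X -> nat,
    (forall c, cyclic_label p (lift_sub gl) (l c)) &
    exists2 e, 0 < e & forall s, small r e s ->
      exists c, forall x y, List.In x s -> List.In y s -> l c x = l c y.
Proof.
move=> p0 gp gfree r1; pose K := [set x | q x <= r]; have Kc := q_compact r1.
have KD x : K x -> D x by move=> /le_lt_trans; apply.
pose C := [set x | D x /\ exists2 y, K y & f y = f x].
have Cc : compact C by exact: f_proper.
have CD x : C x -> D x by case.
have KC x : K x -> C x by move=> Kx; split; [exact: KD|exists x].
have fi i x : D x -> f (iter i g x) = f x by move=> Dx; have [] := lift_iter i gl Dx.
have Di i x : D x -> D (iter i g x) by move=> Dx; have [] := lift_iter i gl Dx.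
have Cg x : C x -> C (g x).
  by move=> [Dx [y Ky fyx]]; split; [exact: (Di 1%N)|exists y; rewrite // (fi 1%N)].
have [d d0 Cd] := unif_inj Cc CD.
have [|s1 s10 Cs1] := unif_cts Cc (g := g) _ d0.
  by move=> x /CD Dx; have [] := gl x Dx.
pose s := Num.min s1 (d / 2).
have s0 : 0 < s by rewrite lt_min s10 divr_gt0.
have sd : s < d.
  by rewrite gt_min; apply/orP; right; rewrite ltr_pdivrMr// ltr_pMr// ltr1n.
have [e e0 Ce] := unif_open Cc CD s0.
(* Points of one cell are then closer than [e], within reach of uniform openness. *)
pose w := e / 2; have w0 : 0 < w by rewrite divr_gt0.
(* The equality clause provides reflexivity outside [C]. *)
pose E c (x y : X) := x = y \/ [/\ C (val x), C (val y),
  cell w c (f (val x)) = cell w c (f (val y)) & `|val x - val y| < d].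
(* Distance below [d] improves to below [s]: [f] takes the value [f (val y)] within [s] of [x], and
   injectivity at radius [d] identifies that point with [y]. The bound d/2 gives transitivity, and
   [s1] gives invariance under [g]. *)
have Enear c x y : E c x y -> `|val x - val y| < s.
  move=> [->|[Cx Cy xy xyd]]; first by rewrite subrr normr0.
  have [|y' [xy' _ fy']] := Ce _ Cx (f (val y)).
    apply: le_lt_trans (cell_small w0 xy) _.
    by rewrite ltr_pdivrMr// ltr_pMr// ltr1n.
  suff -> : val y = y' by [].
  by apply: (Cd _ Cx) => //; apply: lt_trans sd.
pose T := lift_sub gl.
have /choice[l lP] : forall c, exists l, cyclic_label p T l /\
    forall x y, E c x y -> l x = l y.
  move=> c; suff [l] : exists2 l, cyclic_label p T l & forall x y, E c x y -> l x = l y.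
    by exists l.
  apply: cyclic_label_exists => //.
  - by move=> x; apply: val_inj; rewrite val_iter_lift_sub gp//; exact: (valP x).
  - by move=> x; left.
  - by move=> x y [->|[]]; [left|right; rewrite distrC].
  - move=> x y z xy yz; have xs := Enear _ _ _ xy; have ys := Enear _ _ _ yz.
    case: xy yz => [->//|[Cx Cy xyc _]] [<-|[_ Cz yzc _]]; right.
      by split=> //; apply: lt_trans sd.
    split=> //; first by rewrite xyc.
    have sd2 : s <= d / 2 by rewrite ge_min lexx orbT.
    exact: ltr_dist_halves (lt_le_trans xs sd2) (lt_le_trans ys sd2).
  - move=> x y xy; have xs := Enear _ _ _ xy; case: xy => [->|[Cx Cy xyc _]]; first by left.
    right; split; [exact: Cg|exact: Cg| |].
      by rewrite /= !(fi 1%N) ?xyc//; [exact: (valP y)|exact: (valP x)].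
    by apply: Cs1 => //; apply: lt_le_trans xs _; rewrite ge_min lexx.
  - move=> i x ip Exx; have Dx : D (val x) := valP x.
    apply: (gfree i (val x) ip Dx); case: Exx => [/(congr1 val)|[Cgx Cx _ xd]].
      by rewrite val_iter_lift_sub.
    rewrite val_iter_lift_sub in xd.
    by apply: (Cd _ Cx); rewrite ?subrr ?normr0// 1?distrC// fi.
exists l => [c|]; first by have [] := lP c.
have w40 : 0 < w / 4 by rewrite divr_gt0.
have [|e1 e10 Ke1] := unif_cts (W := 'rV[R]_n) Kc (g := f) _ w40.
  by move=> x /KD; exact: f_cts.
exists (Num.min d e1); first by rewrite lt_min d0.
case=> [|x0 t] [tr te]; first by exists [ffun=> true].
have [c cP] := cell_shift (f (val x0)) w0; exists c => x y xt yt.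
suff lx0 z : List.In z (x0 :: t) -> l c x0 = l c z by rewrite -!lx0.
move=> zt; have [_] := lP c; apply; right.
have x0t : List.In x0 (x0 :: t) by left.
have := te _ _ x0t zt; rewrite lt_min => /andP[zd ze1].
split=> //; [exact/KC/tr|exact/KC/tr|].
by apply: cP; apply: Ke1 => //; exact: tr.
Qed.

(** The labels of all the grids are fed to [no_locally_zero_labels] with coefficients in Z/p: on a
    small tuple one label is constant, so the product vanishes. *)
Lemma no_free_lift p g a : (1 < p)%N -> lift_on 1 g -> D a ->
    (forall x, D x -> iter p g x = x) ->
    ~ (forall i x, (0 < i < p)%N -> D x -> iter i g x <> x).
Proof.
move=> p1 gl Da gp gfree; have p0 := ltnW p1.
have /choice[nxt nxtP] : forall r, exists r', r < 1 -> [/\ r <= r', r' < 1 &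
    forall i x, (i < p)%N -> q x <= r -> q (iter i g x) <= r'].
  move=> r; have [r1|r1] := pselect (r < 1); last by exists r => /r1.
  by have [r' r'P] := radius_iter p gl r1; exists r'.
(* Iterates of [g] send the sublevel set of [r k] into that of [r k.+1], so primitives on the latter
   pull back to the former. Starting at [q a] keeps [a] in the innermost set. *)
pose r k := iter k nxt (q a).
have r1 k : r k < 1 by elim: k => [//|k IH]; have [] := nxtP _ IH.
have ar k : q a <= r k.
  elim: k => [|k IH]; first exact: lexx.
  by have [h _ _] := nxtP _ (r1 k); apply: le_trans h.
pose m := size (enum {: {ffun 'I_n -> bool}}).
have [l lab [e e0 le]] := lift_labels gl p0 gp gfree (r1 (2 * m)%N).
pose ls := map l (enum {: {ffun 'I_n -> bool}}).
have InE c : List.In (l c) ls.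
  apply: List.in_map; have : c \in enum {: {ffun 'I_n -> bool}} by rewrite mem_enum.
  elim: (enum _) => //= c' t IH; rewrite in_cons => /predU1P[->|/IH]; [by left|by right].
have pA0 : p%:R = 0 :> 'Z_p := pchar_Zp p1.
pose loc k (u : seq X -> 'Z_p) := locally_zero (r k) u.
apply: (@no_locally_zero_labels X p _ (lift_sub gl) p1 pA0 _ loc (exist _ a Da) _ _ _ _ _ _ ls).
- by move=> x; apply: val_inj; rewrite val_iter_lift_sub gp//; exact: (valP x).
- by move=> k u v uv [d d0 ud]; exists d => // s /ud; rewrite uv.
- by move=> k; exists 1.
- move=> k u v [d d0 ud] [d' d'0 vd']; exists (Num.min d d'); first by rewrite lt_min d0.
  by move=> s sm; rewrite ud ?vd' ?addr0//; apply: small_le sm; rewrite ge_min lexx ?orbT.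
- by move=> k u [d d0 ud]; exists d => // s /ud ->; rewrite oppr0.
- move=> u [d d0 ud]; apply: ud; split=> [x [<-|[]]//|x y [<-|[]]// [<-|[]]//].
  by rewrite subrr normr0.
- move=> k u du uk; have [v dv vk] := locally_zero_primitive (r1 k.+1) (ar k.+1) du uk.
  exists v => // i ip; apply: locally_zero_lift vk => // x xr.
  by have [_ _ h] := nxtP _ (r1 k); exact: h.
- by move=> l' /List.in_map_iff[c [<- _]]; exact: lab.
- rewrite /ls size_map; exists e => // s /le[c lc].
  exact: (bockstein_cup_eq0 _ (InE c) lc).
Qed.

End Deck.

(** * The Euclidean ball *)

Lemma eucl_norm_lt1 (R : realType) n (x : 'rV[R]_n) :
  (eucl_norm x < 1) = (\sum_(i < n) x ord0 i ^+ 2 < 1).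
Proof.
by rewrite /eucl_norm -[X in _ < X]sqrtr1 ltr_sqrt.
Qed.

Lemma sqr_norm_seg (R : realType) n (a x : 'rV[R]_n) t : 0 <= t <= 1 ->
  \sum_(i < n) (seg a x t) ord0 i ^+ 2 <=
  Num.max (\sum_(i < n) a ord0 i ^+ 2) (\sum_(i < n) x ord0 i ^+ 2).
Proof.
move=> /andP[t0 t1]; set M := Num.max _ _.
have aM : \sum_(i < n) a ord0 i ^+ 2 <= M by rewrite le_max lexx.
have xM : \sum_(i < n) x ord0 i ^+ 2 <= M by rewrite le_max lexx orbT.
apply: (@le_trans _ _ ((1 - t) * \sum_(i < n) a ord0 i ^+ 2 + t * \sum_(i < n) x ord0 i ^+ 2)).
  rewrite !mulr_sumr -big_split; apply: ler_sum => i _; rewrite /seg !mxE /=.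
  (* The convexity defect of the square in each coordinate. *)
  rewrite -subr_ge0 (_ : _ - _ = t * (1 - t) * (a ord0 i - x ord0 i) ^+ 2); last ring.
  by rewrite mulr_ge0 ?sqr_ge0// mulr_ge0// subr_ge0.
by nra.
Qed.

Lemma sqr_norm_continuous (R : realType) n :
  continuous (fun x : 'rV[R]_n => \sum_(i < n) x ord0 i ^+ 2).
Proof.
apply: continuous_big => [|i _ x]; first exact: add_continuous.
have c := @coord_continuous R 1 n ord0 i x.
exact: (cvgM c c).
Qed.

Lemma continuous_cts_at (R : realType) (V W : normedModType R) (g : V -> W) x :
  {for x, continuous g} -> cts_at g x.
Proof.
move=> gx e e0.
have := gx (ball (g x) e); rewrite /nbhs /= => /(_ (nbhsx_ballx _ _ e0)) /nbhs_ballP[d d0 dP].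
by exists d => // y yd; have := dP y; rewrite -!ball_normE; apply.
Qed.

Theorem theorem1p2 (R : realType) (n : nat) (f : 'rV[R]_n -> 'rV[R]_n)
    (hn : (2 <= n)%N)
    (f_proper : proper_map_on (@unit_ball R n) f)
    (f_cont : {within (@unit_ball R n), continuous f})
    (f_open : open_map_on (@unit_ball R n) f)
    (f_discrete : discrete_map_on (@unit_ball R n) f)
    (f_branch : branch_set (@unit_ball R n) f = set0) :
  homeomorphism_on (@unit_ball R n) (f @` (@unit_ball R n)) f.
Proof.
pose q (x : 'rV[R]_n) : R := \sum_(i < n) x ord0 i ^+ 2.
have DE x : @unit_ball R n x = (q x < 1) :> Prop by rewrite /unit_ball /= eucl_norm_lt1.
have Do : open (@unit_ball R n).
  have -> : @unit_ball R n = q @^-1` [set r | r < 1] by apply/funext => x; rewrite DE.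
  by apply: open_comp => [x _|]; [exact: sqr_norm_continuous|exact: open_lt].
have fc x : unit_ball x -> {for x, continuous f}.
  by move=> Dx; move: f_cont; rewrite continuous_open_subspace// => /(_ x); apply; rewrite inE.
have q_cts x : cts_at (W := 'rV[R]_n) (W' := R) q x.
  by apply: continuous_cts_at; exact: sqr_norm_continuous.
have q_compact r : r < 1 -> compact [set x | q x <= r].
  move=> r1; apply: bounded_closed_compact.
    (* Each squared coordinate is at most [q x], which bounds the sup norm by 1. *)
    exists 1; split=> // M M1 x /= xr; rewrite (le_trans _ (ltW M1))//.
    apply: ler_norm_coord => // i; rewrite -(@ler_pXn2r _ 2)// ?nnegrE// expr1n.
    rewrite real_normK ?num_real//; apply: le_trans (ltW r1); apply: le_trans xr.
    by rewrite /q (bigD1 i)//= lerDl sumr_ge0// => j _; rewrite sqr_ge0.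
  apply: (@closed_comp _ _ q [set y | y <= r]) => [x _|]; last exact: closed_le.
  exact: sqr_norm_continuous.
have f_open' (x : 'rV[R]_n) : q x < 1 -> forall s, 0 < s -> exists2 e, 0 < e &
    forall z, `|f x - z| < e -> exists y, [/\ `|x - y| < s, q y < 1 & f y = z].
  move=> xq s s0.
  have : nbhs (f x) (f @` (@unit_ball R n `&` ball x s)).
    apply: open_nbhs_nbhs; split; first by apply: f_open; exact: ball_open.
    by exists x => //; split; [rewrite DE|exact: ballxx].
  move=> /nbhs_ballP[e e0 eP]; exists e => // z zx.
  have [|y [Dy xy] <-] := eP z; first by rewrite -ball_normE.
  by exists y; split=> //; [move: xy; rewrite -ball_normE|rewrite -DE].
have f_inj (x : 'rV[R]_n) : q x < 1 -> exists2 r, 0 < r &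
    forall y z, `|x - y| < r -> `|x - z| < r -> f y = f z -> y = z.
  rewrite -DE => Dx.
  have [U [Uo Ux _ _ [_ _ [g [_ _ fgK _]]]]] : local_homeomorphism_at (@unit_ball R n) f x.
    apply: contrapT => nx; suff : branch_set (@unit_ball R n) f x by rewrite f_branch.
    by split.
  have /nbhs_ballP[r r0 rU] : nbhs x U by exact: open_nbhs_nbhs.
  exists r => // y z xy xz; have inU u : `|x - u| < r -> u \in U.
    by move=> xu; rewrite inE; apply: rU; rewrite -ball_normE.
  by move=> fyz; rewrite -(fgK y (inU y xy)) fyz fgK// inU.
have f_proper' C : compact C -> (forall x, C x -> q x < 1) ->
    compact [set x | q x < 1 /\ exists2 y, C y & f y = f x].
  move=> Cc CD.
  have -> : [set x | q x < 1 /\ exists2 y, C y & f y = f x] =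
      @unit_ball R n `&` f @^-1` (f @` C).
    by apply/funext => x; rewrite /= /setI /= -DE.
  have CD' : C `<=` @unit_ball R n by move=> x /CD; rewrite DE.
  apply: f_proper.
    by apply: continuous_compact => //; exact: continuous_subspaceW f_cont.
  exact: image_subset.
have inj x y : unit_ball x -> unit_ball y -> f x = f y -> x = y.
  rewrite !DE => xq yq fxy; apply: contrapT => nxy.
  have fcts (z : 'rV[R]_n) : q z < 1 -> cts_at f z.
    by rewrite -DE => /fc; exact: continuous_cts_at.
  have [p [g [p1 gl gp gfree]]] := finite_order_lift q_cts (@sqr_norm_seg R n) q_compact
    fcts f_open' f_inj f_proper' xq yq fxy nxy.
  exact: (no_free_lift q_cts (@sqr_norm_seg R n) q_compact fcts f_open' f_inj f_proper'
    p1 gl xq gp gfree).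
have [g gP] : exists g : 'rV[R]_n -> 'rV[R]_n, forall x, unit_ball x -> g (f x) = x.
  have /choice[g gP] : forall y, exists x, (f @` @unit_ball R n) y -> unit_ball x /\ f x = y.
    move=> y; have [[x Dx <-]|ny] := pselect ((f @` @unit_ball R n) y); first by exists x.
    by exists 0 => /ny.
  exists g => x Dx; have [|Dg fg] := gP (f x); first by exists x.
  exact: inj.
split=> //.
have fDo : open (f @` @unit_ball R n).
  by rewrite -[@unit_ball R n]setIT; apply: f_open; exact: openT.
exists g; split.
- by move=> _ [x Dx <-]; rewrite gP.
(* Continuity of the inverse is openness of [f]. *)
- rewrite continuous_open_subspace// => _ /[!inE] -[x Dx <-] A; rewrite gP// => Ax.
  have /nbhs_ballP[s s0 sA] := Ax.
  have xq : q x < 1 by rewrite -DE.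
  have [e e0 eP] := f_open' _ xq _ s0; apply/nbhs_ballP; exists e => // z.
  rewrite -ball_normE => /eP[y [xy yq <-]] /=; rewrite gP ?DE//.
  by apply: sA; rewrite -ball_normE.
- by move=> x; rewrite inE => Dx; exact: gP.
- by move=> _ /[!inE] -[x Dx <-]; rewrite gP.
Qed.
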